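(* Let $C$ be a commutative ring, $\lambda\in C$, let $(R,P)$ be a Baxter $C$-algebra of weight $\lambda$, and let $p$ be a prime number. Then $$P(1)^p\equiv\lambda^{p-1}P(1)\pmod p.$$
   Context: Rings and algebras are associative with identity $1$. A Baxter $C$-algebra of weight $\lambda\in C$ is a pair $(R,P)$ where $R$ is a $C$-algebra and $P:R\to R$ is a $C$-linear map with $P(x)P(y)=P(xP(y))+P(P(x)y)+\lambda P(xy)$ for all $x,y\in R$. For $a,b\in R$, $a\equiv b\pmod p$ means $a-b\in pR$. *)

(* Defs.v *)
From HB Require Import structures.
From mathcomp Require Import all_boot all_order all_algebra.

Set Implicit Arguments.
Unset Strict Implicit.
Unset Printing Implicit Defensive.

Import GRing.Theory.
Local Open Scope ring_scope.

(* Associative unital C-algebras in which 1 = 0 is allowed: algType C is built *)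
(* on nzRingType and would exclude the zero algebra.  A record is used because *)
(* HB rejects a new structure joining pzRingType and lmodType above lalgType.  *)
Record pzAlgType (C : comPzRingType) := PzAlg {
  pzalg_ring : pzRingType;
  pzalg_scale : C -> pzalg_ring -> pzalg_ring;
  pzalg_scaleA : forall (a b : C) (x : pzalg_ring),
    pzalg_scale a (pzalg_scale b x) = pzalg_scale (a * b) x;
  pzalg_scale1 : forall x : pzalg_ring, pzalg_scale 1 x = x;
  pzalg_scaleDr : forall (a : C) (x y : pzalg_ring),
    pzalg_scale a (x + y) = pzalg_scale a x + pzalg_scale a y;
  pzalg_scaleDl : forall (a b : C) (x : pzalg_ring),
    pzalg_scale (a + b) x = pzalg_scale a x + pzalg_scale b x;
  pzalg_scaleAl : forall (a : C) (x y : pzalg_ring),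
    pzalg_scale a (x * y) = pzalg_scale a x * y;
  pzalg_scaleAr : forall (a : C) (x y : pzalg_ring),
    pzalg_scale a (x * y) = x * pzalg_scale a y
}.

Definition pzalg_sort (C : comPzRingType) (A : pzAlgType C) : Type :=
  pzalg_ring A.
Coercion pzalg_sort : pzAlgType >-> Sortclass.
Bind Scope ring_scope with pzalg_sort.

HB.instance Definition _ (C : comPzRingType) (A : pzAlgType C) :=
  GRing.PzRing.copy (pzalg_sort A) (pzalg_ring A).
HB.instance Definition _ (C : comPzRingType) (A : pzAlgType C) :=
  GRing.Zmodule_isLmodule.Build C (pzalg_sort A)
    (@pzalg_scaleA C A) (@pzalg_scale1 C A) (@pzalg_scaleDr C A)
    (fun x a b => @pzalg_scaleDl C A a b x).

Definition pzAlg_of_algType (C : comPzRingType) (A : algType C) : pzAlgType C :=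
  @PzAlg C A *:%R (@scalerA C A) (@scale1r C A) (@scalerDr C A)
    (fun a b x => scalerDl x a b) (@scalerAl C A) (@scalerAr C A).

Definition baxter (C : comPzRingType) (lambda : C) (R : pzAlgType C)
    (P : R -> R) : Prop :=
  forall x y : R,
    P x * P y = P (x * P y) + P (P x * y) + lambda *: P (x * y).

Definition eqmodR (R : pzRingType) (p : nat) (a b : R) : Prop :=
  exists r : R, a - b = p%:R * r.

(* Main.v *)
(* Write u_k for the k-th iterate of P at 1. The Baxter identity gives
   u_1 u_k = (k+1) u_(k+1) + k lambda u_k, so that u_1^n is the sum of the
   s(n,k) lambda^(n-k) u_k, where s(n,k) = k! S(n,k) counts the surjections
   from n points onto k points. The binomial coefficients C(m,k) obey the same
   recurrence with lambda = 1, whence m^n = sum_k C(m,k) s(n,k). Comparing this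
   with Fermat's m^p = m mod p, inductively in m, shows that p divides s(p,k)
   for all k > 1, and only the term k = 1 survives. *)
Require Import Defs.
From HB Require Import structures.
From mathcomp Require Import all_boot all_order all_algebra.

Import GRing.Theory.
Local Open Scope ring_scope.

(** The last point has [k'.+1] possible images; the other points cover all values or all but that
    one. *)
Fixpoint surj (n k : nat) : nat :=
  match n, k with
  | 0, 0 => 1
  | n'.+1, k'.+1 => k'.+1 * (surj n' k'.+1 + surj n' k')
  | _, _ => 0
  end.

Lemma surj_small (n k : nat) : (n < k)%N -> surj n k = 0%N.
Proof.
elim: n k => [|n IHn] [|k] //= lt_nk.
by rewrite IHn 1?ltnW // IHn ?muln0.
Qed.

Lemma surjn0 (n : nat) : (0 < n)%N -> surj n 0 = 0%N.
Proof. by case: n. Qed.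

Lemma surjn1 (n : nat) : (0 < n)%N -> surj n 1 = 1%N.
Proof.
case: n => // n _; elim: n => // n IHn.
by rewrite [LHS]/= mul1n -/(surj n.+1 1) IHn.
Qed.

(** Stated over any [nmodType] to serve both powers in [nat] and powers of [P 1] in [R]. *)
Lemma sum_surj {V : nmodType} (F : nat -> V) (n : nat) :
  \sum_(k < n.+2) F k *+ surj n.+1 k =
  \sum_(k < n.+1) (F k *+ k + F k.+1 *+ k.+1) *+ surj n k.
Proof.
rewrite big_ord_recl /= add0r.
under [RHS]eq_bigr => k _ do rewrite mulrnDl -!mulrnA.
rewrite big_split /=.
under eq_bigr => k _ do rewrite /bump /= mulnDr mulrnDr.
rewrite big_split /=; congr (_ + _).
(* The ends vanish: [surj n n.+1] is 0 at the top, the factor k is 0 at the bottom. *)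
by rewrite big_ord_recr big_ord_recl /= surj_small // muln0 !mulr0n addr0 add0r.
Qed.

Lemma expn_sum_surj (m n : nat) :
  (m ^ n = \sum_(k < n.+1) 'C(m, k) * surj n k)%N.
Proof.
elim: n => [|n IHn]; first by rewrite big_ord1 bin0.
have mulrn_nat (x k : nat) : x *+ k = (x * k)%N by rewrite -mulr_natr natn.
under eq_bigr => k _ do rewrite -mulrn_nat.
rewrite [RHS](sum_surj (fun k => 'C(m, k))) expnS IHn big_distrr /=.
apply: eq_bigr => k _; rewrite !mulrn_nat mulnA; congr (_ * _)%N.
(* The identity (k+1) C(m,k+1) = (m-k) C(m,k) is used for k <= m; beyond m both binomials are 0. *)
have [le_km|lt_mk] := leqP k m; last first.
  by rewrite !bin_small ?muln0 // ltnW.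
rewrite [('C(m, k.+1) * _)%N]mulnC mul_bin_left -{1}(subnKC le_km).
by rewrite mulnDl [('C(m, k) * k)%N]mulnC.
Qed.

Lemma dvdn_surj_prime (p k : nat) : prime p -> (1 < k)%N -> (p %| surj p k)%N.
Proof.
move=> p_pr; have p_gt0 := prime_gt0 p_pr.
elim/ltn_ind: k => m IHm m_gt1.
have [lt_pm|le_mp] := ltnP p m; first by rewrite surj_small.
have sp1 := surjn1 _ p_gt0.
have sp0 := surjn0 _ p_gt0.
(* The sum can stop at m <= p, since C(m,k) = 0 beyond. *)
have E : (m ^ p = \sum_(k < m.+1) 'C(m, k) * surj p k)%N.
  rewrite expn_sum_surj -!(big_mkord predT (fun k => 'C(m, k) * surj p k)%N).
  rewrite (@big_cat_nat _ _ _ m.+1) //= [X in (_ + X)%N]big_nat_cond.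
  rewrite [X in (_ + X)%N]big1 ?addn0 // => k /andP[/andP[lt_mk _] _].
  by rewrite bin_small.
move: m m_gt1 E IHm {le_mp} => [|[|m]] // _.
rewrite big_ord_recr 2!big_ord_recl /= sp0 sp1 binn bin1 !muln0 mul1n muln1 => E IHm.
have pS : (p %| \sum_(i < m) 'C(m.+2, bump 0 (bump 0 i)) * surj p (bump 0 (bump 0 i)))%N.
  apply: dvdn_sum => i _; apply: dvdn_mull; apply: IHm => //.
  exact: ltn_ord.
(* Modulo p, the power cancels against the k = 1 term, leaving [pS] and the top term, of coefficient
   1. *)
have /eqP := fermat_little m.+2 p_pr.
rewrite E add0n -addnA -[X in _ == (X %% p)%N]addn0 eqn_modDl mod0n -/(dvdn _ _).
by rewrite dvdn_addr.
Qed.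

Lemma pzalg_scalerAr (C : comPzRingType) (A : pzAlgType C) (a : C) (x y : A) :
  a *: (x * y) = x * (a *: y).
Proof. exact: pzalg_scaleAr. Qed.

Section IteratesAtOne.

Variables (C : comPzRingType) (lambda : C) (R : pzAlgType C).
Variable P : {linear R -> R}.
Hypothesis hP : baxter lambda P.

Lemma baxter_mul_iter (k : nat) :
  P 1 * iter k P 1 = lambda *: iter k P 1 *+ k + iter k.+1 P 1 *+ k.+1.
Proof.
elim: k => [|k IHk]; first by rewrite mulr1 mulr0n add0r.
(* The Baxter identity is taken at x = 1, y = u_k; its middle term is P of the induction
   hypothesis. *)
rewrite [iter k.+1 P 1]/= hP !mul1r IHk linearD !linearMn /= linearZ_LR.
by rewrite addrCA addrAC -mulrSr -mulrS.
Qed.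

Lemma baxter_exp_iter (n : nat) :
  P 1 ^+ n = \sum_(k < n.+1) lambda ^+ (n - k) *: iter k P 1 *+ surj n k.
Proof.
elim: n => [|n IHn]; first by rewrite big_ord1 scale1r.
rewrite (sum_surj (fun k => lambda ^+ (n.+1 - k) *: iter k P 1)) exprS IHn.
rewrite mulr_sumr; apply: eq_bigr => k _.
rewrite mulrnAr; congr (_ *+ _).
rewrite -pzalg_scalerAr baxter_mul_iter scalerDr -!scalerMnr scalerA -exprSr subSS subSn //.
by rewrite -ltnS.
Qed.

End IteratesAtOne.

Theorem corollary2p2 (C : comPzRingType) (lambda : C) (R : pzAlgType C)
    (P : {linear R -> R}) (hP : baxter lambda P) (p : nat) (hp : prime p) :
  eqmodR p (P 1 ^+ p) (lambda ^+ p.-1 *: P 1).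
Proof.
have p_gt0 := prime_gt0 hp.
(* These are the terms k > 1 divided by p; k = 0 gives 0 and k = 1 gives the right-hand side. *)
exists (\sum_(2 <= k < p.+1)
          lambda ^+ (p - k) *: iter k P 1 *+ (surj p k %/ p)).
rewrite (baxter_exp_iter _ _ _ _ hP).
rewrite -(big_mkord predT (fun k => lambda ^+ (p - k) *: iter k P 1 *+ surj p k)).
have sp1 := surjn1 _ p_gt0.
have sp0 := surjn0 _ p_gt0.
rewrite big_ltn // big_ltn ?ltnS // sp0 sp1 mulr0n mulr1n add0r subn1 /=.
rewrite addrAC subrr add0r mulr_sumr !big_nat.
apply: eq_bigr => k /andP[k_gt1 _].
by rewrite mulr_natl -mulrnA divnK // dvdn_surj_prime.
Qed.
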